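(* Let $p\in(0,1)$ be fixed. For every $\delta>0$ and every $\epsilon>0$ there is an integer $N$ such that for all positive integers $m,n$ with $m+n\ge N$, a random bipartite graph $G\in\mathcal B(m,n;p)$ satisfies, with probability at least $1-\epsilon$, the following: each of the two bipartition classes $L(G)$ and $R(G)$ contains a vertex that lies in at most $\left(\tfrac12+\delta\right)|\mathcal A(G)|$ maximal stable sets of $G$. (That is, almost every random bipartite graph satisfies the union-closed sets conjecture up to $\delta$.)
   Context: A random bipartite graph $G\in\mathcal B(m,n;p)$ has bipartition classes $L(G)$ (left side) of size $m\ge 1$ and $R(G)$ (right side) of size $n\ge1$, and each pair $u\in L(G)$, $v\in R(G)$ is joined by an edge independently with probability $p$. A vertex set is stable if no two of its vertices are adjacent, and maximally stable if moreover every vertex outside it has a neighbour in it. $\mathcal A(G)$ denotes the set of maximal stable sets of $G$. *)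

(* Defs.v *)
From HB Require Import structures.
From mathcomp Require Import all_boot all_order all_algebra reals.

Set Implicit Arguments.
Unset Strict Implicit.
Unset Printing Implicit Defensive.

Import Order.TTheory GRing.Theory Num.Theory.
Local Open Scope ring_scope.

Section StableSets.
Variables (V : finType) (e : rel V).

Definition stable (S : {set V}) : bool :=
  [forall u in S, forall v in S, ~~ e u v].

Definition maximally_stable (S : {set V}) : bool :=
  stable S && [forall v in ~: S, exists u in S, e v u].

Definition max_stable_sets : {set {set V}} :=
  [set S : {set V} | maximally_stable S].

End StableSets.

(* A bipartite graph with labelled classes of sizes m and n, given by the
   indicator of its edges: G (i, j) says that left vertex i and right vertex j
   are joined. *)
Definition bigraph (m n : nat) := {ffun 'I_m * 'I_n -> bool}.

Section Bigraph.
Variables m n : nat.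
Implicit Type G : bigraph m n.

Definition vertex : finType := ('I_m + 'I_n)%type.

Definition adj G : rel vertex := fun u v =>
  match u, v with
  | inl i, inr j => G (i, j)
  | inr j, inl i => G (i, j)
  | _, _ => false
  end.

Definition leftc G : {set vertex} := [set inl i | i : 'I_m].
Definition rightc G : {set vertex} := [set inr j | j : 'I_n].

Definition calA G : {set {set vertex}} := max_stable_sets (adj G).

End Bigraph.

Section RandomBigraph.
Variables (R : realType) (m n : nat) (p : R).

(* The mn edge indicators are independent Bernoulli(p) variables, so the
   probability of a single graph is the product of their point masses. *)
Definition bigraph_mass (G : bigraph m n) : R :=
  \prod_(ij : 'I_m * 'I_n) (if G ij then p else 1 - p).

Definition bigraph_prob (E : pred (bigraph m n)) : R :=
  \sum_(G | E G) bigraph_mass G.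

Lemma bigraph_prob_total : bigraph_prob predT = 1.
Proof.
rewrite /bigraph_prob /bigraph_mass.
rewrite -(bigA_distr_bigA (fun _ (b : bool) => if b then p else 1 - p)).
by rewrite big1 // => ij _; rewrite big_bool /= addrC subrK.
Qed.

End RandomBigraph.

Definition has_almost_rare_vertex (R : realType) (m n : nat) (delta : R)
    (G : bigraph m n) (C : {set vertex m n}) : bool :=
  [exists v in C,
     #|[set S in calA G | v \in S]|%:R <= (2^-1 + delta) * #|calA G|%:R].

(* Main.v *)
Require Import Defs.
From HB Require Import structures.
From mathcomp Require Import all_boot all_order all_algebra reals.
From mathcomp Require Import ring lra zify.
From mathcomp Require Import sequences exp.

Set Implicit Arguments.
Unset Strict Implicit.
Unset Printing Implicit Defensive.

Import Order.TTheory GRing.Theory Num.Theory.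
Local Open Scope ring_scope.

(* Maximal stable sets correspond to the closed subsets A of the left class,
   those which are cut out by a set of right vertices.  Let m <= n, the other
   case following by transposition.

   If m is bounded and n is large, every subset of the left class is the
   neighbourhood of some right vertex.  Then all subsets are closed, and a right
   vertex joined to the whole left class lies in a single maximal stable set.

   If m is large, it is enough that all but a small proportion of the closed
   sets A have size at most (1/2 + 1/r) m and fewer than n/2 common
   non-neighbours: averaging over the vertices of a class then yields a rare
   one.  Put q = 1 - p, W = q^-(r+2) and W^j <= n < W^(j+1).
   - With high probability at least half of the sets of size
     a = min ((r+1) j, m/2) are closed, which gives at least about 4^a closed
     sets.
   - With high probability only sets A of bounded size have n/2 common
     non-neighbours, and there are few of those.
   - If (r+1) j > m/2, there are exponentially fewer than 2^m sets of size at
     least (1/2 + 1/r) m.  Otherwise choose b with W^b <= 4^r < W^(b+1).  Closed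
     sets with at most b common non-neighbours are determined by these, so there
     are O(n^b) = O(4^(r j)) of them; and the expected number of sets of size at
     least (1/2 + 1/r) m with more than b common non-neighbours is
     O(4^(r j)) too. *)

(** * Closed sets and maximal stable sets *)

Section ClosedSets.
Variables m n : nat.
Implicit Types (G : bigraph m n) (A : {set 'I_m}) (B : {set 'I_n}).

Definition nonnbr G A : {set 'I_n} := [set j | [forall i in A, ~~ G (i, j)]].

(** Closedness for the Galois connection of non-adjacency between the two classes: [A] already
    contains every left vertex that has no neighbour in [nonnbr G A]. *)
Definition closed_set G A : bool :=
  [forall (i | i \notin A), exists j in nonnbr G A, G (i, j)].

Definition closed_sets G : {set {set 'I_m}} := [set A | closed_set G A].

Lemma nonnbrP G A j :
  reflect (forall i, i \in A -> ~~ G (i, j)) (j \in nonnbr G A).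
Proof. by rewrite inE; apply: (iffP forall_inP). Qed.

Lemma closed_setP G A :
  reflect (forall i, i \notin A -> exists2 j, j \in nonnbr G A & G (i, j))
          (closed_set G A).
Proof.
apply: (iffP forall_inP) => H i iA; first by have /exists_inP := H i iA.
by apply/exists_inP; apply: H.
Qed.

Lemma closed_setE G A : closed_set G A ->
  A = [set i | [forall j in nonnbr G A, ~~ G (i, j)]].
Proof.
move/closed_setP => clA; apply/setP=> i; rewrite inE.
apply/idP/forall_inP => [iA j /nonnbrP|H]; first exact.
by apply: contraT => /clA [j /H /negP].
Qed.

Lemma nonnbr_inj G : {in closed_sets G &, injective (nonnbr G)}.
Proof.
move=> A A'; rewrite !inE => /closed_setE eA /closed_setE eA' e.
by rewrite eA eA' e.
Qed.

(** For closed [A], this is the unique maximal stable set with left part [A]. *)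
Definition extend G A : {set vertex m n} :=
  [set v | match v with inl i => i \in A | inr j => j \in nonnbr G A end].

Lemma extend_inj G : injective (extend G).
Proof.
by move=> A A' /setP e; apply/setP => i; have := e (inl i); rewrite !inE.
Qed.

(** Maximality at right vertices forces the right part of a maximal stable set to consist of all
    common non-neighbours of its left part; maximality at left vertices then says that the left part
    is closed. *)
Lemma calAE G : calA G = extend G @: closed_sets G.
Proof.
apply/setP => S; rewrite inE; apply/idP/imsetP.
- case/andP=> /forall_inP stS /forall_inP mxS.
  pose A : {set 'I_m} := [set i | inl i \in S].
  have st u v : u \in S -> v \in S -> ~~ adj G u v.
    by move=> uS vS; have /forall_inP := stS u uS; apply.
  have mx v : v \notin S -> exists2 u, u \in S & adj G v u.
    by move=> vS; apply/exists_inP/mxS; rewrite inE.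
  have cnA j : (j \in nonnbr G A) = (inr j \in S).
    apply/nonnbrP/idP => [H|jS i]; last by rewrite inE => iS; exact: (st _ _ iS jS).
    apply: contraT => /mx [[i|//] iS /= Gij].
    by move: (H i); rewrite inE Gij => /(_ iS).
  exists A; last first.
    by apply/setP => -[i|j]; rewrite inE ?cnA // inE.
  rewrite inE; apply/closed_setP => i; rewrite inE => /mx [[//|j] jS Gij].
  by exists j; rewrite ?cnA.
- case=> A; rewrite inE => /closed_setP clA ->; apply/andP; split.
    apply/forall_inP => u; rewrite inE => uS; apply/forall_inP => v.
    rewrite inE; case: u v uS => [i|j] [i'|j'] //=.
      by move=> iA /nonnbrP; exact.
    by move=> /nonnbrP H iA; exact: H.
  apply/forall_inP => -[i|j]; rewrite !inE.
    by move=> /clA [j jA Gij]; apply/exists_inP; exists (inr j);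
      rewrite ?inE //; move: jA; rewrite inE.
  rewrite negb_forall_in => /exists_inP [i iA /negPn Gij].
  by apply/exists_inP; exists (inl i); rewrite ?inE.
Qed.

Lemma card_calA G : #|calA G| = #|closed_sets G|.
Proof. by rewrite calAE card_imset //; exact: extend_inj. Qed.

Lemma card_calA_vertex G v :
  #|[set S in calA G | v \in S]| = #|[set A in closed_sets G | v \in extend G A]|.
Proof.
rewrite -(card_imset _ (@extend_inj G)); apply: eq_card => S.
rewrite inE calAE; apply/andP/imsetP.
  by case=> /imsetP [A AF ->] vA; exists A; rewrite // inE AF.
by case=> A; rewrite inE => /andP [AF vA] ->; split=> //; apply: imset_f.
Qed.

End ClosedSets.

(** Double counting of the pairs (x, A) with [x \in tr A]: good members of [F] contribute at most
    [t * #|T|] each and bad ones at most [#|T|], while failure at every x would make the total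
    strictly larger. *)
Lemma average_le (R : realType) (T U : finType) (F : {set U})
    (tr : U -> {set T}) (bad : pred U) (t d : R) :
  (0 < #|T|)%N -> 0 <= t ->
  #|[set A in F | bad A]|%:R <= d * #|F|%:R ->
  (forall A, A \in F -> ~~ bad A -> #|tr A|%:R <= t * #|T|%:R) ->
  exists x, #|[set A in F | x \in tr A]|%:R <= (t + d) * #|F|%:R.
Proof.
move=> T0 t0 badF trF.
case: (pickP (fun x : T => #|[set A in F | x \in tr A]|%:R <= (t + d) * #|F|%:R))
  => [x Hx|H]; first by exists x.
have T0' : (0 : R) < #|T|%:R by rewrite ltr0n.
suff: (t + d) * #|F|%:R * #|T|%:R < (t + d) * #|F|%:R * #|T|%:R by rewrite ltxx.
pose s : R := \sum_(x : T) #|[set A in F | x \in tr A]|%:R.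
apply: (@lt_le_trans _ _ s).
  have -> : (t + d) * #|F|%:R * #|T|%:R = \sum_(x : T) (t + d) * #|F|%:R.
    by rewrite sumr_const mulr_natr.
  have [x0 _] : exists x0 : T, x0 \in T by apply/card_gt0P.
  rewrite /s (bigD1 x0) // [ltRHS](bigD1 x0) //=.
  apply: ltr_leD; first by have := H x0; rewrite leNgt => /negbFE.
  by apply: ler_sum => x _; have := H x; rewrite leNgt => /negbFE /ltW.
have -> : s = \sum_(A in F) #|tr A|%:R.
  rewrite /s -!natr_sum; congr _%:R.
  under eq_bigr do rewrite -sum1_card.
  under [RHS]eq_bigr do rewrite -sum1_card.
  rewrite (exchange_big_dep (mem F)) /=; last by move=> x A _; rewrite inE => /andP[].
  by apply: eq_bigr => A AF; apply: eq_bigl => x; rewrite inE AF.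
apply: (@le_trans _ _ (\sum_(A in F) (t * #|T|%:R + (bad A)%:R * #|T|%:R))).
  apply: ler_sum => A AF; case bA: (bad A); rewrite /= ?mul1r ?mul0r ?addr0.
    by rewrite ler_wpDl ?mulr_ge0 ?ler0n // ler_nat max_card.
  by apply: trF; rewrite ?bA.
rewrite big_split /= sumr_const -mulr_suml -natr_sum.
have -> : (\sum_(A in F) bad A)%N = #|[set A in F | bad A]|.
  rewrite -sum1_card big_mkcond [RHS]big_mkcond /=.
  by apply: eq_bigr => A _; rewrite inE; case: (A \in F); case: (bad A).
apply: le_trans (lerD (lexx _) (ler_wpM2r (ler0n _ _) badF)) _.
by rewrite -mulr_natr le_eqVlt; apply/orP; left; apply/eqP; ring.
Qed.

(** * Rare vertices from few exceptional closed sets *)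

Section RareVertices.
Variables (R : realType) (m n : nat).
Implicit Type G : bigraph m n.

(** Averaging over the left vertices, on which [extend G A] has trace [A]. *)
Lemma has_rare_left G (bad : pred {set 'I_m}) (t d delta : R) :
  (0 < m)%N -> 0 <= t -> t + d <= 2^-1 + delta ->
  #|[set A in closed_sets G | bad A]|%:R <= d * #|closed_sets G|%:R ->
  (forall A, ~~ bad A -> #|A|%:R <= t * m%:R) ->
  has_almost_rare_vertex delta G (leftc G).
Proof.
move=> m0 t0 td badF small.
have [] := @average_le R 'I_m _ (closed_sets G) id bad t d _ t0 badF.
- by rewrite card_ord.
- by move=> A _ /small; rewrite card_ord.
move=> i Hi; apply/exists_inP; exists (inl i); first exact: imset_f.
rewrite card_calA card_calA_vertex.
apply: le_trans (le_trans Hi _); last by rewrite ler_wpM2r ?ler0n.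
by rewrite ler_nat; apply/subset_leq_card/subsetP => A; rewrite !inE.
Qed.

(** Averaging over the right vertices, on which [extend G A] has trace [nonnbr G A]. *)
Lemma has_rare_right G (bad : pred {set 'I_m}) (t d delta : R) :
  (0 < n)%N -> 0 <= t -> t + d <= 2^-1 + delta ->
  #|[set A in closed_sets G | bad A]|%:R <= d * #|closed_sets G|%:R ->
  (forall A, ~~ bad A -> #|nonnbr G A|%:R <= t * n%:R) ->
  has_almost_rare_vertex delta G (rightc G).
Proof.
move=> n0 t0 td badF small.
have [] := @average_le R 'I_n _ (closed_sets G) (nonnbr G) bad t d _ t0 badF.
- by rewrite card_ord.
- by move=> A _ /small; rewrite card_ord.
move=> i Hi; apply/exists_inP; exists (inr i); first exact: imset_f.
rewrite card_calA card_calA_vertex.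
apply: le_trans (le_trans Hi _); last by rewrite ler_wpM2r ?ler0n.
by rewrite ler_nat; apply/subset_leq_card/subsetP => A; rewrite !inE.
Qed.

(* A right vertex joined to the whole left class only lies in the maximal
   stable set [rightc G]. *)
Lemma all_closed_rare G (delta : R) : (0 < m)%N -> 0 <= delta ->
  (forall A : {set 'I_m}, exists j, forall i, G (i, j) = (i \in A)) ->
  has_almost_rare_vertex delta G (leftc G) &&
  has_almost_rare_vertex delta G (rightc G).
Proof.
move=> m0 delta0 full.
have FT : closed_sets G = setT.
  apply/setP => A; rewrite !inE; apply/closed_setP => i iA.
  (* A right vertex with neighbourhood exactly the complement of [A] serves every [i] outside
     [A]. *)
  have [j jA] := full (~: A); exists j; last by rewrite jA inE.
  by apply/nonnbrP => k kA; rewrite jA inE kA.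
have cF : #|closed_sets G| = (2 * 2 ^ m.-1)%N.
  by rewrite FT -powersetT card_powerset cardsT card_ord -expnS prednK.
have half (k : nat) : (k <= 2 ^ m.-1)%N ->
    k%:R <= (2^-1 + delta) * #|closed_sets G|%:R.
  move=> kle; apply: (@le_trans _ _ (2 ^ m.-1)%:R); first by rewrite ler_nat.
  rewrite cF natrM mulrA ler_peMl ?ler0n // mulrDl mulVf ?pnatr_eq0 //.
  by rewrite lerDl mulr_ge0 ?ler0n.
apply/andP; split; apply/exists_inP.
  pose i0 := Ordinal m0; exists (inl i0); first exact: imset_f.
  rewrite card_calA_vertex card_calA; apply: half.
  rewrite -leq_double -!mul2n mul2n -addnn -cF FT.
  set X := [set A in _ | _].
  have -> : #|[set: {set 'I_m}]| = (#|X| + #|~: X|)%N.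
    by rewrite cardsC cardsT.
  (* Complementation sends the sets containing [i0] injectively to sets avoiding it, so the former
     are at most half of all sets. *)
  rewrite leq_add2l -(card_imset _ (@setC_inj 'I_m)).
  apply/subset_leq_card/subsetP => A /imsetP [A' + ->].
  by rewrite !inE /= => ->.
have [j0 jT] := full setT; exists (inr j0); first exact: imset_f.
rewrite card_calA_vertex card_calA; apply: half.
apply: (@leq_trans 1); last by rewrite expn_gt0.
rewrite -(cards1 (set0 : {set 'I_m})); apply/subset_leq_card/subsetP => A.
rewrite !inE => /andP [_ /forall_inP AN]; apply/eqP/setP => i; rewrite inE.
by apply/negP => /AN; rewrite jT inE.
Qed.

End RareVertices.

(** * Probabilities *)

Lemma bin_leq_exp (n c : nat) : ('C(n, c) <= n ^ c)%N.
Proof.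
elim: c => [|c IH]; first by rewrite bin0.
apply: (@leq_trans (c.+1 * 'C(n, c.+1))%N); first exact: leq_pmull.
by rewrite mul_bin_left expnS leq_mul // leq_subr.
Qed.

Section Probability.
Variables (R : realType) (m n : nat) (p : R).
Hypotheses (p_gt0 : 0 < p) (p_lt1 : p < 1).
Local Notation q := (1 - p).
Local Notation P := (@bigraph_prob R m n p).
Implicit Types (G : bigraph m n) (E : pred (bigraph m n)).

Let q_gt0 : 0 < q. Proof. by rewrite subr_gt0. Qed.
Let q_ge0 : 0 <= q. Proof. exact: ltW. Qed.
Let q_le1 : q <= 1. Proof. by rewrite gerBl ltW. Qed.

Lemma bigraph_mass_ge0 G : 0 <= bigraph_mass p G.
Proof. by apply: prodr_ge0 => ij _; case: ifP => _; [exact: ltW|]. Qed.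

Lemma bigraph_prob_le E E' : (forall G, E G -> E' G) -> P E <= P E'.
Proof.
move=> EE'; rewrite /bigraph_prob big_mkcond [leRHS]big_mkcond.
apply: ler_sum => G _; case EG: (E G); first by rewrite EE'.
by case: ifP => // _; exact: bigraph_mass_ge0.
Qed.

Lemma bigraph_prob_compl E : P E = 1 - P (predC E).
Proof.
rewrite -(bigraph_prob_total m n p) /bigraph_prob.
by rewrite [in RHS](bigID E) /= addrK.
Qed.

(** Union bound. *)
Lemma bigraph_prob_exists (I : finType) (S : pred I) (E : I -> pred (bigraph m n)) :
  P (fun G => [exists (i | S i), E i G]) <= \sum_(i | S i) P (E i).
Proof.
rewrite /bigraph_prob (exchange_big_dep predT) //= big_mkcond /=.
apply: ler_sum => G _; rewrite sumr_const; case: ifP => [/exists_inP [i Si Ei]|_].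
  rewrite -[leLHS]mulr1n ler_wpMn2l ?bigraph_mass_ge0 //.
  by apply/card_gt0P; exists i; rewrite unfold_in Si.
by rewrite mulrn_wge0 ?bigraph_mass_ge0.
Qed.

(** Markov's inequality for the number of events [E i] that occur, whose expectation is the sum on
    the right. *)
Lemma bigraph_prob_markov (I : finType) (S : pred I) (E : I -> pred (bigraph m n))
    (t : R) :
  P (fun G => t <= #|[pred i | S i && E i G]|%:R) * t <= \sum_(i | S i) P (E i).
Proof.
rewrite /bigraph_prob (exchange_big_dep predT) //= mulr_suml big_mkcond /=.
apply: ler_sum => G _; rewrite sumr_const -[leRHS]mulr_natr; case: ifP => [tle|_].
  by rewrite ler_wpM2l ?bigraph_mass_ge0.
by rewrite mulr_ge0 ?bigraph_mass_ge0 ?ler0n.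
Qed.

Definition column G (j : 'I_n) : {ffun 'I_m -> bool} := [ffun i => G (i, j)].

Definition column_prob (C : pred {ffun 'I_m -> bool}) : R :=
  \sum_(c | C c) \prod_i (if c i then p else q).

(** Independence of the neighbourhoods of the right vertices: a graph is a family of columns, and
    the product of sums expands into a sum over such families. *)
Lemma bigraph_prob_columns (C : 'I_n -> pred {ffun 'I_m -> bool}) :
  P (fun G => [forall j, C j (column G j)]) = \prod_j column_prob (C j).
Proof.
rewrite /bigraph_prob /column_prob bigA_distr_big_dep /=.
pose g (h : {ffun 'I_n -> {ffun 'I_m -> bool}}) : bigraph m n :=
  [ffun ij => h ij.2 ij.1].
have colg h j : column (g h) j = h j by apply/ffunP => i; rewrite !ffunE.
rewrite (reindex g); last first.
  exists (fun G => [ffun j => column G j]) => h _.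
    by apply/ffunP => j; rewrite ffunE colg.
  by apply/ffunP => -[i j]; rewrite !ffunE.
apply: eq_big => [h|h _].
  by apply/forallP/familyP => H j; have := H j; rewrite colg.
rewrite exchange_big /= pair_big; apply: eq_bigr => -[i j] _ /=.
by rewrite ffunE.
Qed.

Lemma column_prob_prod (Q : 'I_m -> pred bool) :
  column_prob (fun c => [forall i, Q i (c i)]) =
  \prod_i \sum_(b | Q i b) (if b then p else q).
Proof.
rewrite /column_prob bigA_distr_big_dep /=; apply: eq_bigl => c.
by apply/forallP/familyP.
Qed.

Lemma column_prob_compl C : column_prob C = 1 - column_prob (predC C).
Proof.
have -> : 1 = column_prob predT :> R.
  rewrite /column_prob -(bigA_distr_bigA (fun _ b => if b then p else q)).
  by rewrite big1 // => i _; rewrite big_bool /= addrC subrK.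
by rewrite /column_prob [in RHS](bigID C) /= addrK.
Qed.

Lemma column_prob_ge0 C : 0 <= column_prob C.
Proof.
apply: sumr_ge0 => c _; apply: prodr_ge0 => i _.
by case: ifP => _; [exact: ltW|].
Qed.

Lemma column_prob_le (C C' : pred {ffun 'I_m -> bool}) :
  (forall c, C c -> C' c) -> column_prob C <= column_prob C'.
Proof.
move=> CC'; rewrite /column_prob big_mkcond [leRHS]big_mkcond.
apply: ler_sum => c _; case Cc: (C c); first by rewrite CC'.
case: ifP => // _; apply: prodr_ge0 => i _.
by case: ifP => _; [exact: ltW|].
Qed.

Lemma column_prob_zero (A : {set 'I_m}) :
  column_prob (fun c => [forall i in A, ~~ c i]) = q ^+ #|A|.
Proof.
transitivity (column_prob (fun c => [forall i, (i \in A) ==> ~~ c i])).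
  by apply: eq_bigl.
rewrite (column_prob_prod (fun i b => (i \in A) ==> ~~ b)).
rewrite (bigID (mem A)) /= [X in _ * X]big1 ?mulr1.
  rewrite -prodr_const; apply: eq_bigr => i iA.
  by rewrite big_mkcond big_bool /= iA /= add0r.
by move=> i /negbTE iA; rewrite big_mkcond big_bool /= iA /= addrC subrK.
Qed.

(** Difference of the probabilities of vanishing on [A] and of vanishing on [x |: A]: q^|A| -
    q^(|A|+1). *)
Lemma column_prob_zero_one (A : {set 'I_m}) (x : 'I_m) : x \notin A ->
  column_prob (fun c => [forall i in A, ~~ c i] && c x) = p * q ^+ #|A|.
Proof.
move=> xA; have := erefl (column_prob (fun c => [forall i in A, ~~ c i])).
rewrite {2}/column_prob (bigID (fun c : {ffun 'I_m -> bool} => c x)) /=.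
rewrite -!/(column_prob _).
suff -> : column_prob (fun c => [forall i in A, ~~ c i] && ~~ c x) =
    q * column_prob (fun c => [forall i in A, ~~ c i]).
  by rewrite column_prob_zero => e; lra.
rewrite column_prob_zero -exprS.
have -> : #|A|.+1 = #|x |: A| by rewrite cardsU1 xA.
rewrite -column_prob_zero; apply: eq_bigl => c.
apply/andP/forall_inP => [[/forall_inP cA cx] i|H].
  by rewrite !inE => /orP [/eqP ->|/cA].
split; last by apply: H; rewrite setU11.
by apply/forall_inP => i iA; apply: H; rewrite setU1r.
Qed.

Lemma column_prob_eq (c0 : {ffun 'I_m -> bool}) :
  Num.min p q ^+ m <= column_prob (pred1 c0).
Proof.
rewrite /column_prob big_pred1_eq -[m in X in X <= _]card_ord -prodr_const.
apply: ler_prod => i _; apply/andP; split; first by rewrite le_min q_ge0 ltW.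
by case: ifP => _; rewrite ge_min lexx ?orbT.
Qed.

Lemma prob_no_edge (A : {set 'I_m}) (B : {set 'I_n}) :
  P (fun G => B \subset nonnbr G A) = q ^+ (#|A| * #|B|).
Proof.
pose C j : pred {ffun 'I_m -> bool} :=
  fun c => (j \in B) ==> [forall i in A, ~~ c i].
transitivity (P (fun G => [forall j, C j (column G j)])).
  apply: eq_bigl => G; apply/subsetP/forallP => H j.
    apply/implyP => jB; apply/forall_inP => i iA.
    by have /nonnbrP := H j jB; rewrite ffunE; apply.
  move=> jB; apply/nonnbrP => i iA.
  by have /implyP/(_ jB)/forall_inP/(_ i iA) := H j; rewrite ffunE.
rewrite bigraph_prob_columns (bigID (mem B)) /= [X in _ * X]big1 ?mulr1.
  rewrite exprM -prodr_const; apply: eq_bigr => j jB.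
  by rewrite -column_prob_zero; apply: eq_bigl => c; rewrite /C jB.
move=> j /negbTE jB; rewrite column_prob_compl /column_prob big1 ?subr0 // => c.
by rewrite /C /= jB.
Qed.

(** If [A] is not closed, some left vertex i outside [A] is such that no column vanishes on [A] and
    is 1 at i. Each of the n independent columns does so with probability p q^|A|; then sum over
    i. *)
Lemma prob_not_closed (A : {set 'I_m}) :
  P (fun G => ~~ closed_set G A) <= m%:R * (1 - p * q ^+ #|A|) ^+ n.
Proof.
pose E i G := [forall j, ~~ ([forall k in A, ~~ column G j k] && column G j i)].
apply: (@le_trans _ _ (P (fun G => [exists (i | i \notin A), E i G]))).
  apply: bigraph_prob_le => G; rewrite negb_forall_in => /exists_inP [i iA].
  rewrite negb_exists_in => /forall_inP H; apply/exists_inP; exists i => //.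
  apply/forallP => j; apply/negP => /andP [/forall_inP jA].
  rewrite ffunE; apply/negP/H/nonnbrP => k /jA; by rewrite ffunE.
apply: le_trans (bigraph_prob_exists _ _) _.
apply: (@le_trans _ _ (\sum_(i | i \notin A) (1 - p * q ^+ #|A|) ^+ n)).
  apply: ler_sum => i iA.
  rewrite /E (bigraph_prob_columns (fun _ c => ~~ ([forall k in A, ~~ c k] && c i))).
  rewrite (eq_bigr (fun=> 1 - p * q ^+ #|A|)); last first.
    move=> j _; rewrite column_prob_compl -(column_prob_zero_one iA).
    by congr (_ - _); apply: eq_bigl => c /=; rewrite negbK.
  by rewrite prodr_const card_ord.
rewrite sumr_const -[leLHS]mulr_natl ler_wpM2r //; last first.
  by rewrite ler_nat -[X in (_ <= X)%N](card_ord m) max_card.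
rewrite exprn_ge0 // subr_ge0 mulr_ile1 ?exprn_ge0 ?exprn_ile1 // ltW //.
Qed.

(** Union bound over the 2^m possible neighbourhoods, each of which the n independent columns must
    all miss. *)
Lemma prob_missing_column :
  P (fun G => ~~ [forall A : {set 'I_m}, exists j, forall i, G (i, j) == (i \in A)])
  <= 2 ^+ m * (1 - Num.min p q ^+ m) ^+ n.
Proof.
pose c0 (A : {set 'I_m}) : {ffun 'I_m -> bool} := [ffun i => i \in A].
pose E A G := [forall j, ~~ (column G j == c0 A)].
apply: (@le_trans _ _ (P (fun G => [exists (A | true), E A G]))).
  apply: bigraph_prob_le => G; rewrite negb_forall => /existsP [A].
  rewrite negb_exists => /forallP H; apply/exists_inP; exists A => //.
  apply/forallP => j; apply: contra (H j) => /eqP/ffunP e.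
  by apply/forallP => i; have := e i; rewrite !ffunE => ->.
apply: le_trans (bigraph_prob_exists _ _) _.
apply: (@le_trans _ _ (\sum_(A : {set 'I_m}) (1 - Num.min p q ^+ m) ^+ n)).
  apply: ler_sum => A _.
  rewrite /E (bigraph_prob_columns (fun _ c => ~~ (c == c0 A))).
  rewrite prodr_const card_ord lerXn2r ?nnegrE ?column_prob_ge0 //.
    by rewrite subr_ge0 exprn_ile1 ?le_min ?ge_min ?q_ge0 ?q_le1 ?(ltW p_gt0) ?orbT.
  rewrite column_prob_compl lerB //.
  apply: le_trans (column_prob_eq (c0 A)) _.
  by apply: column_prob_le => c /=; rewrite negbK.
by rewrite sumr_const -cardsT -powersetT card_powerset cardsT card_ord -[leLHS]mulr_natl natrX.
Qed.

(** Union bound over the right sets of size exactly [c], of which there are at most n^c. *)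
Lemma prob_many_nonnbr (A : {set 'I_m}) (c : nat) :
  P (fun G => (c <= #|nonnbr G A|)%N) <= n%:R ^+ c * q ^+ (#|A| * c).
Proof.
apply: (@le_trans _ _ (P (fun G =>
    [exists (B : {set 'I_n} | #|B| == c), B \subset nonnbr G A]))).
  apply: bigraph_prob_le => G cle.
  have [s [us ss sA]] : exists s, [/\ uniq s, size s = c & {subset s <= nonnbr G A}].
    exists (take c (enum (nonnbr G A))); split.
    - by rewrite take_uniq ?enum_uniq.
    - by rewrite size_takel // -cardE.
    - by move=> x /mem_take; rewrite mem_enum.
  apply/exists_inP; exists [set x in s].
    by rewrite cardsE; move/card_uniqP: us => ->; rewrite ss.
  by apply/subsetP => x; rewrite inE => /sA.
apply: le_trans (bigraph_prob_exists _ _) _.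
rewrite (eq_bigr (fun=> q ^+ (#|A| * c))); last first.
  by move=> B /eqP cB; rewrite prob_no_edge cB.
rewrite sumr_const -[leLHS]mulr_natl ler_wpM2r ?exprn_ge0 // -natrX ler_nat.
rewrite (_ : #|_| = #|[set B : {set 'I_n} | #|B| == c]|); last by rewrite cardsE.
by rewrite card_draws card_ord bin_leq_exp.
Qed.

(** As m <= n, there are at most 4^n pairs of a left and a right set. A pair of sizes at least K and
    n/2 spans no edge with probability at most 64^(-n/2) = 8^(-n). *)
Lemma prob_large_nonnbr (K : nat) : (m <= n)%N -> q ^+ K <= 64^-1 ->
  P (fun G => [exists (A : {set 'I_m} | (K <= #|A|)%N), (n <= 2 * #|nonnbr G A|)%N]) <= 2^-1 ^+ n.
Proof.
move=> mn qK.
pose S (AB : {set 'I_m} * {set 'I_n}) := (K <= #|AB.1|)%N && (n <= 2 * #|AB.2|)%N.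
apply: (@le_trans _ _ (P (fun G => [exists (AB | S AB), AB.2 \subset nonnbr G AB.1]))).
  apply: bigraph_prob_le => G /exists_inP [A KA nA]; apply/exists_inP.
  by exists (A, nonnbr G A); rewrite /S /= ?KA.
apply: le_trans (bigraph_prob_exists _ _) _.
apply: (@le_trans _ _ (\sum_(AB | S AB) 8^-1 ^+ n)).
  apply: ler_sum => -[A B] /andP [/= KA nB]; rewrite prob_no_edge.
  apply: (@le_trans _ _ ((q ^+ K) ^+ #|B|)).
    by rewrite -exprM; apply: ler_wiXn2l => //; rewrite leq_mul2r KA orbT.
  apply: (@le_trans _ _ (64^-1 ^+ #|B|)).
    by rewrite lerXn2r ?nnegrE ?exprn_ge0 ?invr_ge0.
  have -> : 64^-1 = 8^-1 ^+ 2 :> R by rewrite exprVn; congr _^-1; ring.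
  by rewrite -exprM; apply: ler_wiXn2l nB; lra.
rewrite sumr_const -[leLHS]mulr_natl.
apply: (@le_trans _ _ ((2 ^ m * 2 ^ n)%:R * 8^-1 ^+ n)).
  rewrite ler_wpM2r ?exprn_ge0 ?invr_ge0 // ler_nat.
  apply: leq_trans (max_card _) _; rewrite card_prod.
  by rewrite -!cardsT -!powersetT !card_powerset !cardsT !card_ord.
apply: (@le_trans _ _ ((2 ^ n * 2 ^ n)%:R * 8^-1 ^+ n)).
  rewrite ler_wpM2r ?exprn_ge0 ?invr_ge0 // ler_nat leq_mul2r.
  by rewrite leq_exp2l ?mn ?orbT.
rewrite natrM !natrX -!exprMn lerXn2r ?nnegrE //; lra.
Qed.

End Probability.

(** * Binomial coefficients and real estimates *)

(** Passing from a to a+1 multiplies the right side by (4a+6)/(a+1), which exceeds 4. *)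
Lemma central_bin_ge (a : nat) : (4 ^ a <= (2 * a).+1 * 'C(2 * a, a))%N.
Proof.
elim: a => [|a IH]; first by rewrite muln0 bin0.
have e1 : (2 * a.+1 * 'C((2 * a).+1, a) = a.+1 * 'C(2 * a.+1, a.+1))%N.
  by rewrite -mul_bin_diag mulnS.
have e2 : ((2 * a).+1 * 'C(2 * a, a) = a.+1 * 'C((2 * a).+1, a))%N.
  by have /= -> := mul_bin_down (2 * a).+1 a; congr (_ * _)%N; lia.
rewrite -(leq_pmul2l (ltn0Sn a)) mulnCA -e1 expnS.
have : (a.+1 * 4 ^ a <= a.+1 * (a.+1 * 'C((2 * a).+1, a)))%N.
  by rewrite -e2 leq_pmul2l.
rewrite leq_pmul2l //; nia.
Qed.

Lemma leq_bin_half (m k a : nat) : (k <= a)%N -> (2 * a <= m)%N ->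
  ('C(m, k) <= 'C(m, a))%N.
Proof.
elim: a => [|a IH]; first by rewrite leqn0 => /eqP ->.
rewrite leq_eqVlt => /orP [/eqP -> //|]; rewrite ltnS => ka am.
apply: leq_trans (IH ka _) _; first by lia.
have := mul_bin_left m a; nia.
Qed.

Lemma card_sets_small (T : finType) (K : nat) :
  #|[set A : {set T} | (#|A| < K)%N]| = (\sum_(i < K) 'C(#|T|, i))%N.
Proof.
elim: K => [|K IH].
  rewrite big_ord0; apply/eqP; rewrite cards_eq0; apply/eqP/setP => A.
  by rewrite !inE.
rewrite big_ord_recr /= -IH -card_draws -cardsUI addnC.
rewrite [X in (X + _)%N](_ : _ = 0%N) ?add0n.
  by apply: eq_card => A; rewrite !inE ltnS leq_eqVlt orbC.
apply/eqP; rewrite cards_eq0; apply/eqP/setP => A; rewrite !inE.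
by apply/negP => /andP [/[swap] /eqP ->]; rewrite ltnn.
Qed.

Lemma card_sets_small_exp (T : finType) (b : nat) : (0 < #|T|)%N ->
  (#|[set B : {set T} | (#|B| <= b)%N]| <= b.+1 * #|T| ^ b)%N.
Proof.
move=> T0; rewrite (card_sets_small T b.+1).
rewrite -[X in (_ <= X * _)%N]card_ord -sum_nat_const.
apply: leq_sum => i _; apply: leq_trans (bin_leq_exp _ _) _.
by apply: leq_pexp2l => //; rewrite -ltnS.
Qed.

(** At most K C(|T|, K-1) sets have fewer than K elements, and the ratio of C(|T|, K-1) to C(|T|, K)
    is K/(|T|-K+1). So such sets are rare compared with those of size [a]. *)
Lemma card_sets_small_bin (T : finType) (K a : nat) :
  (K <= a)%N -> (2 * a <= #|T|)%N ->
  (#|[set A : {set T} | (#|A| < K)%N]| * (#|T| - K) <= K ^ 2 * 'C(#|T|, a))%N.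
Proof.
case: K => [_ _|K Ka aT].
  by rewrite (card_sets_small T 0) big_ord0.
have le1 : (#|[set A : {set T} | (#|A| < K.+1)%N]| <= K.+1 * 'C(#|T|, K))%N.
  rewrite card_sets_small -[X in (_ <= X * _)%N]card_ord -sum_nat_const.
  by apply: leq_sum => i _; apply: leq_bin_half; [rewrite -ltnS|lia].
have := leq_bin_half Ka aT; have := mul_bin_left #|T| K; nia.
Qed.

(** * Decay estimates and integer logarithms *)

Section RealBounds.
Variable R : realType.
Implicit Types (x y c eps : R).

(** The single term (cy)^(D+1)/(D+1)! of the exponential series already beats y^D; [Y] is where the
    spare factor y suffices. *)
Lemma exp_decay (D : nat) (c eps : R) : 0 < c -> 0 < eps ->
  exists2 Y : R, 0 < Y & forall y, Y <= y -> y ^+ D * expR (- (c * y)) <= eps.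
Proof.
move=> c0 e0; pose Y := (D.+1)`!%:R / (eps * c ^+ D.+1).
have Y0 : 0 < Y by rewrite divr_gt0 ?ltr0n ?fact_gt0 ?mulr_gt0 ?exprn_gt0.
exists Y => // y Yy; have y0 : 0 < y by apply: lt_le_trans Yy.
rewrite expRN ler_pdivrMr ?expR_gt0 //.
have := @expR_ge1Dxn R (c * y) D (ltW (mulr_gt0 c0 y0)).
have F0 : (0 : R) < (D.+1)`!%:R by rewrite ltr0n fact_gt0.
move=> h; apply: (@le_trans _ _ (eps * ((c * y) ^+ D.+1 / (D.+1)`!%:R))); last first.
  by rewrite ler_wpM2l ?(ltW e0) //; apply: le_trans h; rewrite lerDr.
rewrite mulrA ler_pdivlMr // exprMn.
move: Yy; rewrite ler_pdivrMr ?mulr_gt0 ?exprn_gt0 // => Yy.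
rewrite [y ^+ D.+1]exprS; have yD : 0 <= y ^+ D by rewrite exprn_ge0 ?ltW.
apply: le_trans (ler_wpM2l yD Yy) _; rewrite le_eqVlt; apply/orP; left.
by apply/eqP; ring.
Qed.

Lemma geometric_decay (D : nat) (x eps : R) : 0 < x -> x < 1 -> 0 < eps ->
  exists N : nat, forall n, (N <= n)%N -> n%:R ^+ D * x ^+ n <= eps.
Proof.
move=> x0 x1 e0.
have [|Y Y0 HY] := @exp_decay D (- ln x) eps _ e0.
  by rewrite oppr_gt0 ln_lt0 // x0.
exists (Num.truncn Y).+1 => n Nn.
have := HY n%:R; rewrite mulNr opprK expRM_natr lnK ?posrE //; apply.
by apply/ltW/(lt_le_trans (truncnS_gt Y)); rewrite ler_nat.
Qed.

Lemma linear_geometric_decay (x eps : R) : 0 < x -> x < 1 -> 0 < eps ->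
  exists N : nat, forall n, (N <= n)%N -> n.+1%:R * x ^+ n <= eps.
Proof.
move=> x0 x1 e0; have e2 : 0 < eps / 2 by rewrite divr_gt0.
have [N HN] := geometric_decay 1 x0 x1 e2.
exists N.+1 => n Nn; have := HN n (ltnW Nn).
have n1 : (1 : R) <= n%:R by rewrite ler1n (leq_trans _ Nn).
have xn : 0 <= x ^+ n by rewrite exprn_ge0 ?ltW.
have : x ^+ n <= n%:R * x ^+ n by rewrite ler_peMl.
by rewrite expr1 -[n.+1%:R]natr1 mulrDl mul1r; lra.
Qed.

Lemma pow_unbounded (x Y : R) : 1 < x ->
  exists N : nat, forall n, (N <= n)%N -> Y <= x ^+ n.
Proof.
move=> x1; have x0 : 0 < x by lra.
have Y0 : 0 < (`|Y| + 1)^-1 by rewrite invr_gt0; have := normr_ge0 Y; lra.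
have xi0 : 0 < x^-1 by rewrite invr_gt0.
have [|N HN] := geometric_decay 0 xi0 _ Y0; first by rewrite invf_lt1.
exists N => n /HN; rewrite expr0 mul1r exprVn lef_pV2 ?posrE ?exprn_gt0 //.
  by have := ler_norm Y; lra.
by move: Y0; rewrite invr_gt0.
Qed.

Lemma pow_bracket (x y : R) : 1 < x -> 1 <= y ->
  exists j : nat, x ^+ j <= y < x ^+ j.+1.
Proof.
move=> x1 y1; have [N HN] := pow_unbounded (y + 1) x1.
have ex : exists j, y < x ^+ j by exists N; have := HN N (leqnn _); lra.
have [[|j] yj minj] := ex_minnP ex.
  by move: yj; rewrite expr0 ltNge y1.
exists j; rewrite yj andbT leNgt; apply/negP => /minj.
by rewrite ltnn.
Qed.

Lemma sum_expr_card (T : finType) (z : R) :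
  \sum_(A : {set T}) z ^+ #|A| = (1 + z) ^+ #|T|.
Proof.
rewrite addrC -prodr_const (bigA_distr _ _ (fun=> z) (fun=> 1)).
by apply: eq_bigr => A _; rewrite -big_mkcond prodr_const.
Qed.

(** Both sides equal 2 at x = 1, where the right side has the larger slope, so some x slightly above
    1 works. With t = 1/r and x = exp(t^2/2) the claim becomes cosh(t/2) < exp(t^2). *)
Lemma tail_rate (r : nat) : (0 < r)%N ->
  exists2 x : R, 1 < x & 1 + x ^+ (2 * r) < 2 * x ^+ r.+2.
Proof.
move=> r0; pose t : R := r%:R^-1; pose s := t ^+ 2 / 2.
have rR : (0 : R) < r%:R by rewrite ltr0n.
have t0 : 0 < t by rewrite invr_gt0.
have t1 : t <= 1 by rewrite invf_le1 ?ler1n.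
have s0 : 0 < s by rewrite divr_gt0 ?exprn_gt0.
have rs : r%:R * s = t / 2.
  by rewrite /s expr2 !mulrA mulfV ?mul1r ?gt_eqF.
exists (expR s); first by rewrite expR_gt1.
pose a := expR (t / 2).
have -> : expR s ^+ (2 * r) = a ^+ 2.
  by rewrite mulnC exprM -expRM_natl rs.
have -> : expR s ^+ r.+2 = a * expR (s + s).
  by rewrite -addn2 exprD -expRM_natl rs expr2 -expRD.
have a0 : 0 < a by exact: expR_gt0.
have a1 : 1 + t / 2 <= a by exact: expR_ge1Dx.
have a2 : a * (1 - t / 2) <= 1.
  have := expR_ge1Dx (- (t / 2)); rewrite expRN -/a => h.
  by rewrite mulrC -ler_pdivlMr // mul1r.
have x2 : 1 + (s + s) <= expR (s + s) by exact: expR_ge1Dx.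
have ss : s + s = t ^+ 2 by rewrite /s; field.
move: x2; rewrite ss => x2.
apply: (@lt_le_trans _ _ (2 * (a * (1 + t ^+ 2)))); last first.
  by rewrite ler_pM2l // ler_pM2l.
set h := t / 2 in a1 a2 *; have -> : t = 2 * h by rewrite /h; field.
have h0 : 0 < h by rewrite divr_gt0.
have h1 : h <= 2^-1 by rewrite /h; lra.
(* This is cosh h <= 1/(1-h^2), from 1+h <= exp h <= 1/(1-h). It remains to see that (1+4h^2)(1-h^2)
   > 1, which holds as h <= 1/2. *)
have k : (1 - h ^+ 2) * (1 + a ^+ 2) <= 2 * a.
  have k1 : 0 <= (a - (1 + h)) * (1 - h) by apply: mulr_ge0; lra.
  have k2 : 0 <= (1 - a * (1 - h)) * (a * (1 + h)) by rewrite !mulr_ge0 //; lra.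
  nra.
suff : (1 + a ^+ 2) * (1 - h ^+ 2) < 2 * (a * (1 + (2 * h) ^+ 2)) * (1 - h ^+ 2).
  by rewrite ltr_pM2r //; nra.
rewrite mulrC; apply: le_lt_trans k _.
have : 0 < a * (h ^+ 2 * (3 - 4 * h ^+ 2)).
  by rewrite mulr_gt0 // mulr_gt0 ?exprn_gt0 //; nra.
nra.
Qed.

End RealBounds.

(** * Closed sets of large size *)

(* The condition reads [#|A| >= (1/2 + 1/r) m]; exponential Markov inequality
   for the size of a uniformly random set. *)
Lemma card_large_sets (R : realType) (r : nat) : (0 < r)%N ->
  exists rho : R, [/\ 0 < rho, rho < 1 & forall m : nat,
    #|[set A : {set 'I_m} | (m * r.+2 <= 2 * r * #|A|)%N]|%:R <= (2 * rho) ^+ m].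
Proof.
move=> r0; have [x x1 xr] := tail_rate R r0.
have x0 : 0 < x by lra.
pose X : R := x ^+ r.+2; pose Y : R := x ^+ (2 * r).
have X0 : 0 < X by rewrite exprn_gt0.
have Y0 : 0 < Y by rewrite exprn_gt0.
pose a : R := 1 + Y; pose b : R := 2 * X.
have a0 : 0 < a by rewrite addr_gt0.
have b0 : 0 < b by rewrite mulr_gt0.
exists (a / b); split.
- exact: divr_gt0.
- by rewrite ltr_pdivrMr // mul1r.
move=> m.
have -> : 2 * (a / b) = a / X by rewrite /b; field; rewrite gt_eqF.
rewrite expr_div_n ler_pdivlMr ?exprn_gt0 //.
have := sum_expr_card 'I_m Y; rewrite card_ord => <-.
(* Every large [A] contributes at least X^m to the sum of the Y^|A|, which is (1+Y)^m. *)
rewrite [leLHS]mulr_natl -sumr_const big_mkcond /=; apply: ler_sum => A _.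
rewrite inE; case: ifP => [le_rA|_]; last by rewrite exprn_ge0 ?ltW.
by rewrite -!exprM; apply: ler_weXn2l; rewrite ?ltW // mulnC.
Qed.

(* The inequality is checked on (r+2)-th powers, where [q ^+ r.+2] is the
   inverse of [W] and no real exponents are needed. *)
Lemma large_set_weight (R : realFieldType) (q : R) (r j c m n a : nat) :
  0 < q -> q < 1 -> (0 < r)%N ->
  4 ^+ r <= (q^-1 ^+ r.+2) ^+ c -> n%:R <= (q^-1 ^+ r.+2) ^+ j.+1 ->
  (2 * (r.+1 * j) <= m)%N -> (m * r.+2 <= 2 * r * a)%N ->
  n%:R ^+ c * q ^+ (a * c) <= (q^-1 ^+ r.+2) ^+ c * (4 ^+ (r * j) / 2 ^+ m).
Proof.
move=> q0 q1 r0; set W := q^-1 ^+ r.+2 => Wc nW jm ma.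
have W0 : 0 < W by rewrite exprn_gt0 ?invr_gt0.
have qW : q ^+ r.+2 * W = 1 by rewrite /W exprVn mulfV // expf_neq0 ?gt_eqF.
(* This makes the natural subtraction [a - r.+2 * j] below exact. *)
clearbody W; have aj : (r.+2 * j <= a)%N by nia.
have nc : n%:R ^+ c <= W ^+ c * W ^+ (j * c).
  rewrite -exprD -mulSn exprM lerXn2r ?nnegrE ?ler0n // exprn_ge0 // ltW //.
apply: le_trans (ler_wpM2r _ nc) _; first by rewrite exprn_ge0 ?ltW.
rewrite -mulrA ler_pM2l ?exprn_gt0 //.
rewrite ler_pdivlMr ?exprn_gt0 //.
set Z := _ * 2 ^+ m.
have Z0 : 0 <= Z by do 2?apply: mulr_ge0; rewrite exprn_ge0 // ltW.
rewrite -(@ler_pXn2r _ r.+2) ?nnegrE ?exprn_ge0 //.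
(* The extra factor completes the powers of W so that they cancel all the powers of q. Then
   2^(m(r+2)) <= 4^(ra), and 4^r <= W^c absorbs all but 4^(rj(r+2)). *)
have ZE : Z ^+ r.+2 * (W ^+ c) ^+ (a - r.+2 * j) = 2 ^+ (m * r.+2).
  have <- : (W ^+ (j * c)) ^+ r.+2 * (q ^+ (a * c)) ^+ r.+2 *
      (W ^+ c) ^+ (a - r.+2 * j) * (2 ^+ m) ^+ r.+2 = 2 ^+ (m * r.+2).
    rewrite [X in X * _]mulrAC -!exprM -exprD.
    have -> : (j * c * r.+2 + c * (a - r.+2 * j) = a * c)%N by nia.
    by rewrite [(a * c * _)%N]mulnC [q ^+ _]exprM -exprMn [W * _]mulrC qW expr1n mul1r.
  by rewrite /Z !exprMn; ring.
have Wa : 0 < (W ^+ c) ^+ (a - r.+2 * j) by rewrite !exprn_gt0.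
rewrite -(ler_pM2r Wa) ZE.
apply: (@le_trans _ _ (2 ^+ (2 * (r * a)))).
  by apply: ler_weXn2l; [lra|nia].
have -> : 2 ^+ (2 * (r * a)) =
    (4 ^+ (r * j)) ^+ r.+2 * (4 ^+ r) ^+ (a - r.+2 * j) :> R.
  rewrite exprM (_ : 2 ^+ 2 = 4 :> R); last by ring.
  by rewrite -!exprM -exprD; congr (_ ^+ _); nia.
by rewrite ler_pM2l ?exprn_gt0 // lerXn2r ?nnegrE ?exprn_ge0 // ltW.
Qed.

Section Tail.
Variables (R : realType) (m n : nat) (p : R).
Hypotheses (p_gt0 : 0 < p) (p_lt1 : p < 1).
Local Notation q := (1 - p).
Local Notation P := (@bigraph_prob R m n p).
Implicit Types (G : bigraph m n) (A : {set 'I_m}).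

Let q_gt0 : 0 < q. Proof. by rewrite subr_gt0. Qed.
Let q_ge0 : 0 <= q. Proof. exact: ltW. Qed.

(** If the event holds, at least half of the sets of size [a] are not closed; Markov's inequality
    costs the factor 2. *)
Lemma prob_few_closed (a : nat) : (a <= m)%N ->
  P (fun G => (2 * #|closed_sets G| < 'C(m, a))%N) <=
  2 * m%:R * (1 - p * q ^+ a) ^+ n.
Proof.
move=> am; pose t : R := 'C(m, a)%:R / 2.
have C0 : (0 : R) < 'C(m, a)%:R by rewrite ltr0n bin_gt0.
have t0 : 0 < t by rewrite divr_gt0.
pose S A := #|A| == a; pose E A G := ~~ closed_set G A.
have cS : #|[set A | S A]| = 'C(m, a) by rewrite card_draws card_ord.
apply: (@le_trans _ _ (P (fun G => t <= #|[pred A | S A && E A G]|%:R))).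
  apply: bigraph_prob_le => // G few; rewrite ler_pdivrMr // -natrM ler_nat.
  have : (#|[set A | S A]| <= #|closed_sets G| + #|[set A | S A && E A G]|)%N.
    apply: leq_trans (leq_card_setU _ _); apply/subset_leq_card/subsetP => A.
    by rewrite !inE /E => ->; rewrite orbN.
  rewrite cS (_ : #|[set A | S A && E A G]| = #|[pred A | S A && E A G]|).
    by lia.
  by apply: eq_card => A; rewrite !inE.
rewrite -(ler_pM2r t0); apply: le_trans (bigraph_prob_markov _ _ _ _ _) _ => //.
apply: (@le_trans _ _ (\sum_(A | S A) m%:R * (1 - p * q ^+ a) ^+ n)).
  by apply: ler_sum => A /eqP <-; exact: prob_not_closed.
rewrite sumr_const (_ : #|S| = 'C(m, a)); last by rewrite -cS cardsE.
by rewrite -[leLHS]mulr_natr /t le_eqVlt; apply/orP; left; apply/eqP; field.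
Qed.

(** Markov's inequality: by [large_set_weight] each of the 2^m left sets adds at most [w / 2 ^+ m]
    to the expected number. *)
Lemma prob_many_large (r j c : nat) (t : R) : 0 < t -> (0 < r)%N ->
  4 ^+ r <= (q^-1 ^+ r.+2) ^+ c -> n%:R <= (q^-1 ^+ r.+2) ^+ j.+1 ->
  (2 * (r.+1 * j) <= m)%N ->
  P (fun G => (q^-1 ^+ r.+2) ^+ c * 4 ^+ (r * j) / t <=
    #|[pred A : {set 'I_m} | (m * r.+2 <= 2 * r * #|A|)%N &
      (c <= #|nonnbr G A|)%N]|%:R) <= t.
Proof.
move=> t0 r0 Wc nW jm; set w := _ ^+ c * 4 ^+ (r * j).
have w0 : 0 < w by rewrite mulr_gt0 ?exprn_gt0 ?invr_gt0.
have wt0 : 0 < w / t by rewrite divr_gt0.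
rewrite -(ler_pM2r wt0); apply: le_trans (bigraph_prob_markov p_gt0 p_lt1 _ _ _) _.
have -> : t * (w / t) = \sum_(A : {set 'I_m}) (w / 2 ^+ m).
  rewrite sumr_const -cardsT -powersetT card_powerset cardsT card_ord.
  by rewrite -[RHS]mulr_natr natrX divfK ?expf_neq0 ?pnatr_eq0 // mulrC divfK ?gt_eqF.
rewrite big_mkcond /=; apply: ler_sum => A _; case: ifP => [le_rA|_]; last first.
  by rewrite divr_ge0 ?exprn_ge0 // ltW.
apply: le_trans (prob_many_nonnbr _ _ _ _ _) _ => //.
by rewrite /w -mulrA; apply: large_set_weight => //; rewrite gtrBl.
Qed.

(** Closed sets with at most [b] common non-neighbours inject, through [nonnbr G], into the right
    sets of size at most [b]; the second summand covers the other large ones. *)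
Lemma card_closed_large G (r b : nat) : (0 < n)%N ->
  (#|[set A in closed_sets G | (m * r.+2 <= 2 * r * #|A|)%N]| <=
   b.+1 * n ^ b + #|[pred A : {set 'I_m} | (m * r.+2 <= 2 * r * #|A|)%N &
      (b < #|nonnbr G A|)%N]|)%N.
Proof.
move=> n0; pose X := [set A in closed_sets G | (#|nonnbr G A| <= b)%N].
have cX : (#|X| <= b.+1 * n ^ b)%N.
  rewrite -(card_in_imset (f := nonnbr G)); last first.
    by move=> A A'; rewrite !inE => /andP[AF _] /andP[A'F _]; apply: nonnbr_inj; rewrite inE.
  have := @card_sets_small_exp 'I_n b; rewrite card_ord => /(_ n0); apply: leq_trans.
  apply/subset_leq_card/subsetP => B /imsetP [A + ->].
  by rewrite !inE => /andP [].
rewrite -[X in (_ <= _ + X)%N]cardsE.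
apply: leq_trans (leq_add cX (leqnn _)); apply: leq_trans (leq_card_setU _ _).
apply/subset_leq_card/subsetP => A; rewrite !inE => /andP [-> ->] /=.
by rewrite leqNgt orNb.
Qed.

End Tail.

(** * Proportions of exceptional closed sets *)

Section Counting.
Variables (R : realType) (m n : nat).
Implicit Type G : bigraph m n.

(** There are O(4^(rj)) large closed sets, since n^b <= W^b 4^(rj), against at least 4^((r+1)j) /
    (2(2(r+1)j+1)) closed sets. The last hypothesis compares the two after division by 4^(rj). *)
Lemma few_large_sparse G (r j b : nat) (W t d : R) :
  (0 < n)%N -> 1 <= W -> 0 < t -> n%:R <= W ^+ j.+1 -> W ^+ b <= 4 ^+ r ->
  (2 * (r.+1 * j) <= m)%N -> ('C(m, r.+1 * j) <= 2 * #|closed_sets G|)%N ->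
  #|[pred A : {set 'I_m} | (m * r.+2 <= 2 * r * #|A|)%N &
      (b < #|nonnbr G A|)%N]|%:R <= W ^+ b.+1 * 4 ^+ (r * j) / t ->
  (b.+1%:R * W ^+ b + W ^+ b.+1 / t) * (2 * (2 * (r.+1 * j)).+1%:R) <= d * 4 ^+ j ->
  #|[set A in closed_sets G | (m * r.+2 <= 2 * r * #|A|)%N]|%:R
    <= d * #|closed_sets G|%:R.
Proof.
move=> n0 W1 t0 nW Wb am CF few num.
have := card_closed_large G r b n0; rewrite -(ler_nat R) natrD natrM natrX.
move: few; set X := #|_|%:R; set F := #|_|%:R; set S := #|_|%:R => few XY.
have W0 : 0 <= W by lra.
pose z : R := 4 ^+ (r * j); have z0 : 0 < z by rewrite exprn_gt0.
have nb : n%:R ^+ b <= W ^+ b * z.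
  apply: (@le_trans _ _ ((W ^+ j.+1) ^+ b)).
    by rewrite lerXn2r ?nnegrE ?ler0n ?exprn_ge0.
  rewrite -exprM mulSn exprD ler_wpM2l ?exprn_ge0 //.
  by rewrite /z mulnC !exprM lerXn2r ?nnegrE ?exprn_ge0.
pose C0 := b.+1%:R * W ^+ b + W ^+ b.+1 / t.
have XC : X <= C0 * z.
  apply: le_trans XY _.
  have -> : C0 * z = b.+1%:R * (W ^+ b * z) + W ^+ b.+1 * z / t.
    by rewrite /C0; ring.
  by apply: lerD few; rewrite ler_wpM2l ?ler0n.
pose s : R := (2 * (r.+1 * j)).+1%:R.
have s0 : 0 < s by rewrite ltr0n.
have d0 : 0 <= d.
  have C00 : 0 <= C0.
    by apply: addr_ge0; rewrite ?mulr_ge0 ?ler0n ?exprn_ge0 ?invr_ge0 // ltW.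
  have j0 : (0 : R) < 4 ^+ j by rewrite exprn_gt0.
  rewrite -(pmulr_lge0 _ j0); apply: le_trans num; rewrite -/C0 -/s.
  by rewrite mulr_ge0 // mulr_ge0 // ltW.
have s2 : 0 < 2 * s by rewrite mulr_gt0.
apply: le_trans XC _; rewrite -(ler_pM2r s2) mulrAC.
apply: (@le_trans _ _ (d * 4 ^+ j * z)); first by rewrite ler_wpM2r // ltW.
have -> : d * 4 ^+ j * z = d * 4 ^+ (r.+1 * j).
  by rewrite /z mulSn exprD mulrA.
rewrite -mulrA ler_wpM2l //.
have := central_bin_ge (r.+1 * j); rewrite -(ler_nat R) natrX natrM -/s => h.
apply: le_trans h _.
have -> : F * (2 * s) = s * (2 * F) by ring.
rewrite ler_pM2l // -natrM ler_nat; apply: leq_trans CF.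
exact: leq_bin2l.
Qed.

(** The central binomial coefficient gives at least 2^m / (4(m+1)) closed sets, exponentially more
    than (2 rho)^m when rho < 1. *)
Lemma few_large_dense G (r : nat) (rho d : R) :
  0 <= rho -> ('C(m, m./2) <= 2 * #|closed_sets G|)%N ->
  #|[set A : {set 'I_m} | (m * r.+2 <= 2 * r * #|A|)%N]|%:R <= (2 * rho) ^+ m ->
  4 * (m.+1%:R * rho ^+ m) <= d ->
  #|[set A in closed_sets G | (m * r.+2 <= 2 * r * #|A|)%N]|%:R
    <= d * #|closed_sets G|%:R.
Proof.
move=> rho0 CF tail num; set F := #|closed_sets G|%:R.
have F2 : 2 ^+ m <= 4 * m.+1%:R * F.
  have m2 : m = (odd m + 2 * m./2)%N by rewrite mul2n odd_double_half.
  have h4 : (2 ^ m <= 2 * 4 ^ m./2)%N.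
    rewrite {1}m2 expnD expnM leq_mul2r; apply/orP; right.
    by case: (odd m).
  have c1 := central_bin_ge m./2.
  have c2 : ('C(2 * m./2, m./2) <= 'C(m, m./2))%N by apply: leq_bin2l; lia.
  have : (2 ^ m <= 4 * m.+1 * #|closed_sets G|)%N.
    have : ((2 * m./2).+1 * 'C(2 * m./2, m./2) <= m.+1 * (2 * #|closed_sets G|))%N.
      by apply: leq_mul; [lia|exact: leq_trans CF].
    move=> h; apply: leq_trans h4 _.
    apply: leq_trans (leq_mul (leqnn 2) (leq_trans c1 h)) _.
    by move: #|closed_sets G| => k; lia.
  by rewrite -(ler_nat R) natrX !natrM.
apply: (@le_trans _ _ ((2 * rho) ^+ m)).
  apply: le_trans tail; rewrite ler_nat.
  by apply/subset_leq_card/subsetP => A; rewrite !inE => /andP [].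
have rm : 0 <= rho ^+ m by rewrite exprn_ge0.
rewrite exprMn; apply: le_trans (ler_wpM2r rm F2) _.
have -> : 4 * m.+1%:R * F * rho ^+ m = 4 * (m.+1%:R * rho ^+ m) * F by ring.
by rewrite ler_wpM2r ?ler0n.
Qed.

(** The sets counted have fewer than [K] elements, hence are few compared with the C(m, a) sets of
    size [a], at least half of which is the number of closed sets. *)
Lemma few_with_many_nonnbr G (K a : nat) (d : R) :
  (K <= a)%N -> (2 * a <= m)%N -> (K < m)%N ->
  ('C(m, a) <= 2 * #|closed_sets G|)%N ->
  ~~ [exists (A : {set 'I_m} | (K <= #|A|)%N), (n <= 2 * #|nonnbr G A|)%N] ->
  2 * (K ^ 2)%:R <= d * (m - K)%:R ->
  #|[set A in closed_sets G | (n <= 2 * #|nonnbr G A|)%N]|%:R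
    <= d * #|closed_sets G|%:R.
Proof.
move=> Ka am Km CF /exists_inPn noA num.
have mK : (0 : R) < (m - K)%:R by rewrite ltr0n subn_gt0.
rewrite -(ler_pM2r mK).
apply: (@le_trans _ _ (K ^ 2 * (2 * #|closed_sets G|))%:R).
  rewrite -natrM ler_nat.
  apply: (@leq_trans (K ^ 2 * 'C(m, a))); last by rewrite leq_mul2l CF orbT.
  have := @card_sets_small_bin 'I_m K a Ka; rewrite card_ord => /(_ am).
  apply: leq_trans; rewrite leq_mul2r; apply/orP; right.
  apply/subset_leq_card/subsetP => A; rewrite !inE => /andP [_ nA].
  by rewrite ltnNge; apply/negP => /noA; rewrite nA.
rewrite natrM natrM mulrA [_ * 2]mulrC.
by rewrite [leRHS]mulrAC ler_wpM2r ?ler0n.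
Qed.

End Counting.

(** * Exchanging the two classes *)

Section Isomorphism.
Variables (V V' : finType) (e : rel V) (e' : rel V') (f : V -> V') (g : V' -> V).
Hypotheses (fK : cancel f g) (gK : cancel g f).
Hypothesis ef : forall u v, e' (f u) (f v) = e u v.

Lemma maximally_stable_iso (S : {set V}) :
  maximally_stable e' (f @: S) = maximally_stable e S.
Proof.
have mem v : (v \in f @: S) = (g v \in S).
  by rewrite -[in LHS](gK v) mem_imset //; exact: can_inj fK.
have memf u : (f u \in f @: S) = (u \in S) by rewrite mem fK.
congr (_ && _); first apply/forall_inP/forall_inP => H u uS.
- apply/forall_inP => v vS; rewrite -ef.
  by have := H (f u); rewrite memf => /(_ uS) /forall_inP; apply; rewrite memf.
- apply/forall_inP => v vS; rewrite -(gK u) -(gK v) ef.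
  by have := H (g u); rewrite -mem => /(_ uS) /forall_inP; apply; rewrite -mem.
apply/forall_inP/forall_inP => H v; rewrite inE => vS.
- have := H (f v); rewrite inE memf => /(_ vS) /exists_inP [u uS]; rewrite -(gK u) ef => evu.
  by apply/exists_inP; exists (g u); rewrite // -mem.
- have := H (g v); rewrite inE -mem => /(_ vS) /exists_inP [u uS evu].
  apply/exists_inP; exists (f u); first by rewrite memf.
  by rewrite -(gK v) ef.
Qed.

(** The predicate [Q] lets one bijection count both all maximal stable sets and those through a
    given vertex. *)
Lemma card_max_stable_iso (Q : pred {set V'}) :
  #|[set S in max_stable_sets e' | Q S]| =
  #|[set S in max_stable_sets e | Q (f @: S)]|.
Proof.
have fI : injective f := can_inj fK.
rewrite -(card_imset _ (imset_inj fI)); apply: eq_card => S; rewrite inE.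
apply/andP/imsetP => [[SA QS]|[T]]; last first.
  by rewrite !inE => /andP [TA QT] ->; rewrite maximally_stable_iso.
have eS : S = f @: (g @: S).
  by rewrite -imset_comp -[LHS]imset_id; apply: eq_imset => v /=; rewrite gK.
exists (g @: S) => //; rewrite !inE in SA *.
by rewrite -maximally_stable_iso -eS SA.
Qed.

End Isomorphism.

Section Transpose.
Variables m n : nat.

Definition transpose (G : bigraph m n) : bigraph n m :=
  [ffun ji => G (ji.2, ji.1)].

Definition swap_vertex (v : vertex m n) : vertex n m :=
  match v with inl i => inr i | inr j => inl j end.

End Transpose.

Lemma transposeK m n : cancel (@transpose m n) (@transpose n m).
Proof. by move=> G; apply/ffunP => -[i j]; rewrite !ffunE. Qed.

Lemma swap_vertexK m n : cancel (@swap_vertex m n) (@swap_vertex n m).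
Proof. by case. Qed.

Lemma adj_transpose m n (G : bigraph m n) u v :
  adj (transpose G) (swap_vertex u) (swap_vertex v) = adj G u v.
Proof. by case: u v => [i|j] [i'|j'] //=; rewrite ffunE. Qed.

Lemma rare_vertex_transpose (R : realType) m n (delta : R) (G : bigraph m n)
    (C : {set vertex n m}) :
  has_almost_rare_vertex delta (transpose G) C ->
  has_almost_rare_vertex delta G (@swap_vertex n m @: C).
Proof.
case/exists_inP => v vC; set N := #|_|; set N' := #|_|.
have iso := card_max_stable_iso (@swap_vertexK m n) (@swap_vertexK n m) (adj_transpose G).
have -> : N = #|[set S in calA G | swap_vertex v \in S]|.
  rewrite /N iso; apply: eq_card => S; rewrite !inE; congr (_ && _).
  rewrite -[v in LHS]swap_vertexK mem_imset //; exact: can_inj (@swap_vertexK m n).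
have -> : N' = #|calA G|.
  have := iso predT; rewrite /N' /calA => iso'.
  transitivity #|[set S in max_stable_sets (adj (transpose G)) | predT S]|.
    by apply: eq_card => S; rewrite !inE andbT.
  by rewrite iso'; apply: eq_card => S; rewrite !inE andbT.
by move=> le; apply/exists_inP; exists (swap_vertex v); first exact: imset_f.
Qed.

Lemma swap_leftc m n (G : bigraph m n) (H : bigraph n m) :
  @swap_vertex m n @: leftc G = rightc H.
Proof. by rewrite /leftc -imset_comp; apply: eq_imset. Qed.

Lemma swap_rightc m n (G : bigraph m n) (H : bigraph n m) :
  @swap_vertex m n @: rightc G = leftc H.
Proof. by rewrite /rightc -imset_comp; apply: eq_imset. Qed.

Lemma bigraph_prob_transpose (R : realType) m n (p : R) (E : pred (bigraph n m)) :
  bigraph_prob p E = bigraph_prob p (fun G : bigraph m n => E (transpose G)).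
Proof.
rewrite /bigraph_prob (reindex (@transpose m n)) /=; last first.
  exists (@transpose n m) => G _; exact: transposeK.
apply: eq_bigr => G _; rewrite /bigraph_mass.
rewrite (reindex (fun ij : 'I_m * 'I_n => (ij.2, ij.1))) /=; last first.
  by exists (fun ji => (ji.2, ji.1)) => -[].
by apply: eq_bigr => -[i j] _; rewrite ffunE.
Qed.

(** * Large and small classes *)

Lemma bigraph_prob_or (R : realType) m n (p : R) (E E' : pred (bigraph m n)) :
  0 < p -> p < 1 ->
  bigraph_prob p (fun G => E G || E' G) <= bigraph_prob p E + bigraph_prob p E'.
Proof.
move=> p0 p1; rewrite /bigraph_prob (bigID E) /=; apply: lerD.
  rewrite le_eqVlt; apply/orP; left; apply/eqP; apply: eq_bigl => G.
  by rewrite andb_idl // => ->.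
rewrite big_mkcond [leRHS]big_mkcond; apply: ler_sum => G _.
case: (E G); case: (E' G) => //=; exact: bigraph_mass_ge0.
Qed.

(** With 1-x <= exp(-x), the exponent satisfies n q^a >= W^j q^((r+1)j) = Q^j, where W = Q^(r+2),
    and the factor m is at most W^(j+1). The bound is thus a power of y = Q^j times exp(-py). *)
Lemma prob_few_closed_decay (R : realType) (p : R) (m n r a j : nat) :
  let Q := (1 - p)^-1 in 0 < p -> p < 1 -> (m <= n)%N -> (a <= m)%N ->
  (a <= r.+1 * j)%N -> (Q ^+ r.+2) ^+ j <= n%:R -> n%:R <= (Q ^+ r.+2) ^+ j.+1 ->
  bigraph_prob p (fun G : bigraph m n => (2 * #|closed_sets G| < 'C(m, a))%N) <=
  2 * Q ^+ r.+2 * ((Q ^+ j) ^+ r.+2 * expR (- (p * Q ^+ j))).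
Proof.
move=> Q p0 p1 mn am aj Wn nW.
have q0 : 0 < 1 - p by lra.
have Q0 : 0 < Q by rewrite invr_gt0.
apply: le_trans (prob_few_closed n p0 p1 am) _.
have x1 : p * (1 - p) ^+ a <= 1.
  by rewrite mulr_ile1 ?exprn_ge0 ?exprn_ile1 //; lra.
have -> : 2 * Q ^+ r.+2 * ((Q ^+ j) ^+ r.+2 * expR (- (p * Q ^+ j))) =
    2 * ((Q ^+ r.+2) ^+ j.+1) * expR (- (p * Q ^+ j)).
  by rewrite [(Q ^+ r.+2) ^+ j.+1]exprS [(Q ^+ j) ^+ _]exprAC !mulrA.
apply: ler_pM.
- by rewrite mulr_ge0 ?ler0n.
- by rewrite exprn_ge0 // subr_ge0.
- by rewrite ler_pM2l //; apply: le_trans nW; rewrite ler_nat.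
apply: (@le_trans _ _ (expR (- (p * (1 - p) ^+ a)) ^+ n)).
  rewrite lerXn2r ?nnegrE ?expR_ge0 ?subr_ge0 //.
  exact: expR_ge1Dx.
rewrite -expRM_natr ler_expR mulNr lerN2 -mulrA ler_pM2l //.
apply: (@le_trans _ _ ((1 - p) ^+ (r.+1 * j) * (Q ^+ r.+2) ^+ j)).
  rewrite -exprM [(r.+2 * j)%N]mulSn exprD mulrCA -exprMn.
  by rewrite mulfV ?gt_eqF // expr1n mulr1.
apply: ler_pM Wn; [by rewrite exprn_ge0 // ltW|by rewrite !exprn_ge0 // ltW|].
by apply: ler_wiXn2l => //; lra.
Qed.

(** Outside three exceptional events, each of probability at most eps/3, the averaging lemmas apply
    to both classes. *)
Lemma large_classes (R : realType) (p delta eps : R) :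
  0 < p -> p < 1 -> 0 < delta -> 0 < eps ->
  exists M : nat, forall m n : nat, (M <= m)%N -> (m <= n)%N ->
    1 - eps <= bigraph_prob p (fun G : bigraph m n =>
      has_almost_rare_vertex delta G (leftc G) &&
      has_almost_rare_vertex delta G (rightc G)).
Proof.
move=> p0 p1 delta0 eps0.
pose q := 1 - p; have q0 : 0 < q by rewrite /q; lra.
have q1 : q < 1 by rewrite /q; lra.
pose Q := q^-1; have Q0 : 0 < Q by rewrite invr_gt0.
have Q1 : 1 < Q by rewrite invf_gt1.
(* On the left, one half of [delta] pays for the excess size 1/r and the other for the proportion of
   large closed sets. *)
have [d d0 dE] : exists2 d : R, 0 < d & d + d = delta.
  by exists (delta / 2); [rewrite divr_gt0|field].
have [r r00 rd] : exists2 r : nat, (0 < r)%N & r%:R^-1 <= d.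
  exists (Num.truncn d^-1).+1 => //; rewrite invf_ple ?posrE ?ltr0n //.
  by apply/ltW/truncnS_gt.
have r0 : (0 : R) < r%:R by rewrite ltr0n.
pose W := Q ^+ r.+2; have W1 : 1 < W by rewrite exprn_egt1.
have W0 : 0 < W by lra.
have [|b /andP [Wb Wc]] := @pow_bracket R W (4 ^+ r) W1.
  by rewrite exprn_ege1 //; lra.
have [e e0 eE] : exists2 e : R, 0 < e & e + (e + e) = eps.
  by exists (eps / 3); [rewrite divr_gt0|field].
have [K HK] : exists K, q ^+ K <= 64^-1.
  have [|K HK] := @geometric_decay R 0 q 64^-1 q0 q1; first by rewrite invr_gt0.
  by exists K; have := HK K (leqnn _); rewrite expr0 mul1r.
pose C0 := b.+1%:R * W ^+ b + W ^+ b.+1 / e.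
have C00 : 0 < C0.
  by rewrite addr_gt0 // ?mulr_gt0 ?ltr0n ?invr_gt0 ?exprn_gt0.
have [J2 HJ2] : exists J, forall j, (J <= j)%N ->
    C0 * (2 * (2 * (r.+1 * j)).+1%:R) <= d * 4 ^+ j.
  have D0 : 0 < C0 * (4 * r.+1%:R) by rewrite !mulr_gt0 ?ltr0n.
  have [|||J HJ] := @linear_geometric_decay R 4^-1 (d / (C0 * (4 * r.+1%:R))).
  - by rewrite invr_gt0.
  - by rewrite invf_lt1 // ltr1n.
  - by rewrite divr_gt0.
  exists J => j /HJ; rewrite exprVn ler_pdivrMr ?exprn_gt0 //.
  rewrite mulrAC ler_pdivlMr // => h.
  apply: le_trans h; rewrite [leRHS]mulrCA ler_pM2l // -!natrM ler_nat.
  by clear; nia.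
have [J1 HJ1] : exists J, forall j, (J <= j)%N ->
    2 * W * ((Q ^+ j) ^+ r.+2 * expR (- (p * Q ^+ j))) <= e.
  have [|Y Y0 HY] := @exp_decay R r.+2 p (e / (2 * W)) p0.
    by rewrite divr_gt0 // pmulr_rgt0.
  have [J HJ] := pow_unbounded Y Q1.
  exists J => j /HJ /HY; rewrite ler_pdivlMr; last by rewrite pmulr_rgt0.
  by rewrite mulrC.
have [rho [rho0 rho1 Hrho]] := card_large_sets R r00.
have [|M3 HM3] := @linear_geometric_decay R rho (d / 4) rho0 rho1.
  by rewrite divr_gt0.
have [|||M4 HM4] := @geometric_decay R 0 2^-1 e; rewrite ?invr_gt0 //.
  by rewrite invf_lt1 // ltr1n.
pose J := maxn K (maxn J1 J2).
have [M2 HM2] : exists M, forall m, (M <= m)%N ->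
    (K < m)%N /\ 2 * (K ^ 2)%:R <= delta * (m - K)%:R.
  exists (K + (Num.truncn (2 * (K ^ 2)%:R / delta)).+1)%N => m Km.
  split; first by apply: leq_trans Km; rewrite addnS ltnS leq_addr.
  rewrite [leRHS]mulrC -ler_pdivrMr //; apply/ltW/(lt_le_trans (truncnS_gt _)).
  by rewrite ler_nat leq_subRL // (leq_trans _ Km) // leq_addr.
have [M5 HM5] : exists M, forall m, (M <= m)%N -> W ^+ J <= m%:R.
  exists (Num.truncn (W ^+ J)).+1 => m Mm.
  by apply/ltW/(lt_le_trans (truncnS_gt _)); rewrite ler_nat.
exists (2 * K + M2 + M3 + M4 + M5).+1 => m n Mm mn.
have [K2 M2m M3m M4n M5m] : [/\ 2 * K <= m, M2 <= m, M3 <= m, M4 <= n & M5 <= m]%N.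
  by clear -Mm mn; split; lia.
have [m0 n0] : (0 < m)%N /\ (0 < n)%N by clear -Mm mn; split; lia.
have [|j /andP [Wn nW]] := @pow_bracket R W n%:R W1; first by rewrite ler1n.
(* Since W^J <= m <= n < W^(j+1), the exponent j passes all the thresholds gathered in [J]. *)
have Jj : (J <= j)%N.
  rewrite leqNgt; apply/negP => jJ.
  have : n%:R < n%:R :> R; last by rewrite ltxx.
  apply: (lt_le_trans nW); apply: (@le_trans _ _ (W ^+ J)).
    by apply: ler_weXn2l => //; apply: ltW.
  exact: HM5 (leq_trans M5m mn).
have [JK JJ1 JJ2] : [/\ K <= j, J1 <= j & J2 <= j]%N.
  by apply/and3P; rewrite -!geq_max.
have Kj : (K <= r.+1 * j)%N by apply: leq_trans JK _; exact: leq_pmull.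
pose sparse := (2 * (r.+1 * j) <= m)%N.
pose a := if sparse then (r.+1 * j)%N else m./2.
have m2 : (2 * m./2 <= m < 2 * (m./2).+1)%N.
  by rewrite -{2 3}(odd_double_half m); case: (odd m); rewrite -mul2n; clear; lia.
have [Ka am aj] : [/\ K <= a, 2 * a <= m & a <= r.+1 * j]%N.
  by rewrite /a /sparse; case: (leqP (2 * (r.+1 * j)) m) => h; split; move: h K2 Kj m2;
    move: (r.+1 * j)%N m./2 => s h; clear; lia.
(* [E1]: too few closed sets. [E2]: too many large sets with more than [b] common non-neighbours,
   asked only in the sparse case. [E3]: some set of at least [K] left vertices has n/2 common
   non-neighbours. *)
pose E1 (G : bigraph m n) := (2 * #|closed_sets G| < 'C(m, a))%N.
pose E2 (G : bigraph m n) := sparse && (W ^+ b.+1 * 4 ^+ (r * j) / e <=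
   #|[pred A : {set 'I_m} | (m * r.+2 <= 2 * r * #|A|)%N &
      (b < #|nonnbr G A|)%N]|%:R).
pose E3 (G : bigraph m n) :=
  [exists (A : {set 'I_m} | (K <= #|A|)%N), (n <= 2 * #|nonnbr G A|)%N].
have P1 : bigraph_prob p E1 <= e.
  apply: le_trans (prob_few_closed_decay p0 p1 mn _ aj Wn (ltW nW)) _.
    by apply: leq_trans am; exact: leq_pmull.
  exact: HJ1.
have P2 : bigraph_prob p E2 <= e.
  rewrite /E2; case Hs: sparse => /=; last first.
    by rewrite /bigraph_prob big_pred0_eq ltW.
  exact: (prob_many_large p0 p1 e0 r00 (ltW Wc) (ltW nW) Hs).
have P3 : bigraph_prob p E3 <= e.
  apply: le_trans (prob_large_nonnbr p0 p1 mn HK) _.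
  by have := HM4 n; rewrite expr0 mul1r; exact.
rewrite bigraph_prob_compl lerB //.
apply: (@le_trans _ _ (bigraph_prob p (fun G => E1 G || (E2 G || E3 G)))); last first.
  apply: le_trans (bigraph_prob_or _ _ p0 p1) _.
  apply: le_trans (lerD P1 (bigraph_prob_or _ _ p0 p1)) _.
  apply: le_trans (lerD (lexx _) (lerD P2 P3)) _.
  by rewrite eE.
apply: bigraph_prob_le => // G /=; apply: contraNT; rewrite !negb_or.
case/and3P; rewrite /E1 -leqNgt => CF nE2 nE3.
have two0 : (0 : R) < 2 by [].
apply/andP; split.
  apply: (@has_rare_left _ _ _ G (fun A => m * r.+2 <= 2 * r * #|A|)%N
    (2^-1 + r%:R^-1) d) => //.
  - by rewrite addr_ge0 // ?invr_ge0 ?ler0n.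
  - by rewrite -addrA lerD2l; rewrite -dE lerD2r.
  - case Hs: sparse; rewrite /a Hs in CF.
      apply: (few_large_sparse n0 (ltW W1) e0 (ltW nW) Wb Hs CF).
        by move: nE2; rewrite /E2 Hs /= -ltNge => /ltW.
      exact: HJ2.
    apply: (few_large_dense (ltW rho0) CF (Hrho m)).
    by rewrite mulrC -ler_pdivlMr //; exact: HM3.
  move=> A; rewrite -ltnNge => mA.
  have mA' : 2 * r%:R * #|A|%:R <= m%:R * (r%:R + 2) :> R.
    by rewrite -[2]/(2%:R) -natrD -!natrM ler_nat; move: mA; clear; lia.
  have -> : (2^-1 + r%:R^-1) * m%:R = m%:R * (r%:R + 2) / (2 * r%:R) :> R.
    by field; rewrite gt_eqF.
  by rewrite ler_pdivlMr ?mulr_gt0 // mulrC.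
(* On the right the good traces have density at most 1/2, so all of [delta] is left for the
   exceptional sets. *)
apply: (@has_rare_right _ _ _ G (fun A => n <= 2 * #|nonnbr G A|)%N 2^-1 delta) => //.
- by rewrite invr_ge0.
- have [Km HK2] : (K < m)%N /\ 2 * (K ^ 2)%:R <= delta * (m - K)%:R.
    exact: HM2.
  exact: (few_with_many_nonnbr Ka am Km CF nE3).
move=> A; rewrite -ltnNge => nA; rewrite mulrC ler_pdivlMr // -natrM ler_nat.
by move: nA; clear; lia.
Qed.

(** For bounded m and large n, every subset of the left class is likely to be the neighbourhood of a
    right vertex, and [all_closed_rare] applies. *)
Lemma small_classes (R : realType) (p delta eps : R) (M : nat) :
  0 < p -> p < 1 -> 0 <= delta -> 0 < eps ->
  exists N : nat, forall m n : nat, (0 < m)%N -> (m <= M)%N -> (N <= n)%N ->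
    1 - eps <= bigraph_prob p (fun G : bigraph m n =>
      has_almost_rare_vertex delta G (leftc G) &&
      has_almost_rare_vertex delta G (rightc G)).
Proof.
move=> p0 p1 delta0 eps0; pose mu := Num.min p (1 - p).
have mu0 : 0 < mu by rewrite lt_min p0; lra.
have mu1 : mu < 1 by rewrite gt_min p1.
(* A base uniform in all m up to [M]; the exponent [M.+1] keeps [x] positive even for [M = 0]. *)
pose x := 1 - mu ^+ M.+1.
have muM0 : 0 < mu ^+ M.+1 by rewrite exprn_gt0.
have muM1 : mu ^+ M.+1 < 1 by rewrite exprn_ilt1 // ltW.
have x0 : 0 < x by rewrite /x; lra.
have x1 : x < 1 by rewrite /x; lra.
have M20 : (0 : R) < 2 ^+ M by rewrite exprn_gt0.
have [|N HN] := @geometric_decay R 0 x (eps / 2 ^+ M) x0 x1.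
  by rewrite divr_gt0.
exists N => m n m0 mM /HN; rewrite expr0 mul1r ler_pdivlMr // mulrC => xn.
rewrite bigraph_prob_compl lerB //; apply: le_trans xn.
apply: le_trans (@bigraph_prob_le _ _ _ _ p0 p1 _ _ _) _; last first.
  apply: le_trans (prob_missing_column m n p0 p1) _.
  have y0 : 0 <= 1 - mu ^+ m by rewrite subr_ge0 exprn_ile1 // ltW.
  have yx : 1 - mu ^+ m <= x.
    by rewrite /x lerB // ler_wiXn2l ?ltW // leqW.
  apply: ler_pM; [exact: exprn_ge0|exact: exprn_ge0| |].
    by apply: ler_weXn2l => //; rewrite ler1n.
  by apply: lerXn2r yx; rewrite nnegrE // ltW.
move=> G /=; apply: contraNN => /forallP full.
apply: all_closed_rare => // A; have /existsP [j /forallP jA] := full A.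
by exists j => i; apply/eqP.
Qed.

Theorem theorem2 (R : realType) (p : R) (p_gt0 : 0 < p) (p_lt1 : p < 1)
    (delta eps : R) (delta_gt0 : 0 < delta) (eps_gt0 : 0 < eps) :
  exists N : nat, forall m n : nat,
    (0 < m)%N -> (0 < n)%N -> (N <= m + n)%N ->
    1 - eps <= bigraph_prob p (fun G : bigraph m n =>
      has_almost_rare_vertex delta G (leftc G) &&
      has_almost_rare_vertex delta G (rightc G)).
Proof.
have [M HM] := large_classes p_gt0 p_lt1 delta_gt0 eps_gt0.
have [N HN] := small_classes M p_gt0 p_lt1 (ltW delta_gt0) eps_gt0.
(* The larger class has at least half of all the vertices, so the threshold 2N gives n >= N; the
   case n < m follows by transposition. *)
have main m n : (0 < m)%N -> (m <= n)%N -> (2 * N <= m + n)%N ->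
    1 - eps <= bigraph_prob p (fun G : bigraph m n =>
      has_almost_rare_vertex delta G (leftc G) &&
      has_almost_rare_vertex delta G (rightc G)).
  move=> m0 mn Nmn; case: (leqP M m) => mM; first exact: HM.
  by apply: HN => //; lia.
exists (2 * N)%N => m n m0 n0 Nmn; case: (leqP m n) => mn; first exact: main.
apply: le_trans (main n m n0 (ltnW mn) _) _; first by rewrite addnC.
rewrite [leRHS]bigraph_prob_transpose; apply: bigraph_prob_le => // G.
case/andP => rl rr.
rewrite -(transposeK G) in rl rr.
have {}rl := rare_vertex_transpose rl; have {}rr := rare_vertex_transpose rr.
rewrite (swap_leftc _ (transpose G)) in rl; rewrite (swap_rightc _ (transpose G)) in rr.
by rewrite rl rr.
Qed.
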